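(* Let $d\ge1$ and let $\Omega\subset\mathbb R^d$ be a regular set with $\mu_d(\Omega)>0$. Let $f:\Omega\to\mathbb R$ be bounded and continuous almost everywhere on $\Omega$, with $\mathcal{ER}(f)=[\inf_\Omega f,\sup_\Omega f]$. Take any closed $d$-dimensional rectangle $[\mathbf a,\mathbf b]$ containing $\Omega$, any sequence of $d$-indices $\mathbf n=\mathbf n(n)\in\mathbb N^d$ with $\mathbf n\to\infty$ as $n\to\infty$, and any asymptotically uniform grid $\mathcal G_{\mathbf n}^{(n)}=\{\mathbf x_{\mathbf i,\mathbf n}^{(n)}\}_{\mathbf i=\mathbf 1,\ldots,\mathbf n}$ in $[\mathbf a,\mathbf b]$. For every $n$ define $\mathcal I_{\mathbf n}^{(n)}(\Omega)=\{\mathbf i\in\{\mathbf 1,\ldots,\mathbf n\}:\mathbf x_{\mathbf i,\mathbf n}^{(n)}\in\Omega\}$, consider the multiset of samples $\{f(\mathbf x_{\mathbf i,\mathbf n}^{(n)}):\mathbf i\in\mathcal I_{\mathbf n}^{(n)}(\Omega)\}$ and a multiset of $|\mathcal I_{\mathbf n}^{(n)}(\Omega)|$ real numbers $\{\lambda_{\mathbf i,\mathbf n}^{(n)}:\mathbf i\in\mathcal I_{\mathbf n}^{(n)}(\Omega)\}$ such that: (i) the sequence of multisets $\{\{\lambda_{\mathbf i,\mathbf n}^{(n)}:\mathbf i\in\mathcal I_{\mathbf n}^{(n)}(\Omega)\}\}_n$ has an asymptotic distribution described by $f$; (ii) $\{\lambda_{\mathbf i,\mathbf n}^{(n)}:\mathbf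 i\in\mathcal I_{\mathbf n}^{(n)}(\Omega)\}\subseteq[\inf_\Omega f-\epsilon_n,\sup_\Omega f+\epsilon_n]$ for every $n$, for some sequence $\epsilon_n\to0$. Then, if $\sigma_n$ and $\tau_n$ are permutations of $\mathcal I_{\mathbf n}^{(n)}(\Omega)$ such that the vectors $[f(\mathbf x_{\sigma_n(\mathbf i),\mathbf n}^{(n)})]_{\mathbf i\in\mathcal I_{\mathbf n}^{(n)}(\Omega)}$ and $[\lambda_{\tau_n(\mathbf i),\mathbf n}^{(n)}]_{\mathbf i\in\mathcal I_{\mathbf n}^{(n)}(\Omega)}$ are sorted in increasing order (indices $\mathbf i$ taken in lexicographic order), we have $$\max_{\mathbf i\in\mathcal I_{\mathbf n}^{(n)}(\Omega)}|f(\mathbf x_{\sigma_n(\mathbf i),\mathbf n}^{(n)})-\lambda_{\tau_n(\mathbf i),\mathbf n}^{(n)}|\to0\quad(n\to\infty).$$ In particular, $\min_\tau\max_{\mathbf i\in\mathcal I_{\mathbf n}^{(n)}(\Omega)}|f(\mathbf x_{\mathbf i,\mathbf n}^{(n)})-\lambda_{\tau(\mathbf i),\mathbf n}^{(n)}|\to0$ as $n\to\infty$, where the minimum is over all permutations $\tau$ of $\mathcal I_{\mathbf n}^{(n)}(\Omega)$.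
   Context: $\mu_d$ is Lebesgue measure on $\mathbb R^d$. A set $\Omega\subset\mathbb R^d$ is regular if it is bounded and $\mu_d(\partial\Omega)=0$. For measurable $f:\Omega\to\mathbb C$, the essential range is $\mathcal{ER}(f)=\{z\in\mathbb C:\mu_d\{\mathbf x\in\Omega: |f(\mathbf x)-z|<\epsilon\}>0\ \forall\epsilon>0\}$. Multi-index notation: for $\mathbf n\in\mathbb N^d$, $\mathbf n\to\infty$ means $\min_j n_j\to\infty$; $\{\mathbf 1,\ldots,\mathbf n\}=\{\mathbf i\in\mathbb Z^d:\mathbf 1\le\mathbf i\le\mathbf n\}$ componentwise, ordered lexicographically; operations like $\mathbf i(\mathbf b-\mathbf a)/\mathbf n$ are componentwise. A family $\mathcal G_{\mathbf n}^{(n)}=\{\mathbf x_{\mathbf i,\mathbf n}^{(n)}\}_{\mathbf i=\mathbf 1,\ldots,\mathbf n}$ of points in $\mathbb R^d$ (not necessarily inside $[\mathbf a,\mathbf b]$) is an asymptotically uniform (a.u.) grid in $[\mathbf a,\mathbf b]$ if $\max_{\mathbf i=\mathbf 1,\ldots,\mathbf n}\|\mathbf x_{\mathbf i,\mathbf n}^{(n)}-(\mathbf a+\mathbf i(\mathbf b-\mathbf a)/\mathbf n)\|_\infty\to0$ as $n\to\infty$. A sequence of finite multisets of numbers $\{\Lambda_n=\{\lambda_{1,n},\ldots,\lambda_{d_n,n}\}\}_n$ with $d_n\to\infty$ has an asymptotic distribution described by a measurable $f:\Omega\subset\mathbb R^d\to\mathbb C$ with $0<\mu_d(\Omega)<\infty$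 if $\lim_{n\to\infty}\frac1{d_n}\sum_{i=1}^{d_n}F(\lambda_{i,n})=\frac1{\mu_d(\Omega)}\int_\Omega F(f(\mathbf x))\,d\mathbf x$ for every continuous $F:\mathbb C\to\mathbb C$ with bounded support. *)

(* Defs.v *)
From HB Require Import structures.
From mathcomp Require Import all_boot all_order all_algebra.
From mathcomp Require Import finmap.
From mathcomp Require Import all_classical all_reals all_analysis.
Set Implicit Arguments. Unset Strict Implicit. Unset Printing Implicit Defensive.
Import Order.TTheory GRing.Theory Num.Theory numFieldNormedType.Exports.
Local Open Scope classical_set_scope.
Local Open Scope ring_scope.

(* Points of R^d are d-tuples of reals; d.-tuple R carries the (product) Borel
   sigma-algebra of mathcomp-analysis.  Multi-indices are d-tuples of nat. *)

Section Defs.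
Context {R : realType} {d : nat}.
Notation pt := (d.-tuple R).

(* Lebesgue measure on R^d: the (unique) measure on the Borel sets of R^d
   giving every closed box its volume. *)
Definition is_lebesgue_d (mu : {measure set pt -> \bar R}) : Prop :=
  forall a b : pt,
    mu [set x : pt | forall j : 'I_d, tnth a j <= tnth x j <= tnth b j] =
    (\prod_(j < d) Num.max 0 (tnth b j - tnth a j))%:E.

(* Outer measure induced by mu (for Lebesgue: Lebesgue outer measure,
   which coincides with Lebesgue measure on Lebesgue measurable sets). *)
Definition muo (mu : {measure set pt -> \bar R}) (A : set pt) : \bar R :=
  ereal_inf [set mu B | B in [set B : set pt | measurable B /\ A `<=` B]].

Definition near_pt (x y : pt) (r : R) : Prop :=
  forall j : 'I_d, `|tnth x j - tnth y j| < r.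

Definition boundary (Om : set pt) : set pt :=
  [set x | forall r : R, 0 < r ->
     (exists y, Om y /\ near_pt y x r) /\ (exists z, ~ Om z /\ near_pt z x r)].

Definition bounded_set (Om : set pt) : Prop :=
  exists M : R, forall x, Om x -> forall j : 'I_d, `|tnth x j| <= M.

Definition regular (mu : {measure set pt -> \bar R}) (Om : set pt) : Prop :=
  bounded_set Om /\ muo mu (boundary Om) = 0%E.

Definition cont_at_within (Om : set pt) (f : pt -> R) (x : pt) : Prop :=
  forall e : R, 0 < e -> exists2 r : R, 0 < r &
    forall y, Om y -> near_pt y x r -> `|f y - f x| < e.

Definition ae_continuous (mu : {measure set pt -> \bar R}) (Om : set pt) (f : pt -> R) : Prop :=
  muo mu [set x | Om x /\ ~ cont_at_within Om f x] = 0%E.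

Definition bounded_on (Om : set pt) (f : pt -> R) : Prop :=
  exists M : R, forall x, Om x -> `|f x| <= M.

Definition ess_range (mu : {measure set pt -> \bar R}) (Om : set pt) (f : pt -> R) : set R :=
  [set z : R | forall e : R, 0 < e ->
     (0 < muo mu [set x | Om x /\ (`|f x - z| < e)%R])%E].

Definition mindex_box (n : d.-tuple nat) : set (d.-tuple nat) :=
  [set i | forall j : 'I_d, (1 <= tnth i j <= tnth n j)%N].

Definition lexlt (i k : d.-tuple nat) : Prop :=
  exists j : 'I_d, (forall l : 'I_d, (l < j)%N -> tnth i l = tnth k l) /\
                   (tnth i j < tnth k j)%N.

Definition mindex_to_infty (N : nat -> d.-tuple nat) : Prop :=
  forall M : nat, \forall n \near \oo, forall j : 'I_d, (M <= tnth (N n) j)%N.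

Definition au_grid (a b : pt) (N : nat -> d.-tuple nat)
    (x : nat -> d.-tuple nat -> pt) : Prop :=
  forall e : R, 0 < e -> \forall n \near \oo,
    forall i, mindex_box (N n) i -> forall j : 'I_d,
      `|tnth (x n i) j -
        (tnth a j + (tnth i j)%:R * (tnth b j - tnth a j) / (tnth (N n) j)%:R)|
      <= e.

Definition card_set (A : set (d.-tuple nat)) : nat := (#|` fset_set A|)%fset.

Definition asymp_distr (mu : {measure set pt -> \bar R}) (Is : nat -> set (d.-tuple nat))
    (lam : nat -> d.-tuple nat -> R) (Om : set pt) (f : pt -> R) : Prop :=
  ((fun n => (card_set (Is n))%:R : R) @ \oo --> +oo) /\
  forall F : R -> R, continuous F ->
    (exists M : R, forall t, M < `|t| -> F t = 0) ->
    (fun n => (card_set (Is n))%:R^-1 *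
                \sum_(i <- fset_set (Is n)) F (lam n i)) @ \oo -->
    (fine (muo mu Om))^-1 * Rintegral mu Om (F \o f).

Definition max_dev (Is : set (d.-tuple nat)) (g h : d.-tuple nat -> R) : R :=
  \big[Num.max/0]_(i <- fset_set Is) `|g i - h i|.

End Defs.

(* Main.v *)
Require Import Defs.
From HB Require Import structures.
From mathcomp Require Import all_boot all_order all_algebra.
From mathcomp Require Import finmap all_classical all_reals all_analysis.
From mathcomp Require Import lra ring.
Import Order.TTheory GRing.Theory Num.Theory numFieldNormedType.Exports.
Local Open Scope classical_set_scope.
Local Open Scope ring_scope.

(** If some sorted sample exceeds the equally ranked [lambda] by more than
    [e], then for one of finitely many thresholds [t] and some [h > 0] with
    [t + h] in the range of [f], at least as many [lambda]'s lie below [t] as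
    samples lie below [t + 2h].  This is impossible for large [n].
    By (i), the proportion of [lambda <= t] is asymptotically at most
    [mu {f < t + h/2} / mu Om].  The proportion of samples [< t + 2h] is
    asymptotically at least [mu {f < t + 2h} / mu Om], because grid points
    fill open sets at least according to their volume.  The second quotient
    is strictly larger, since [t + h] belongs to the essential range.  The
    opposite deviation is the same statement for [-f] and [-lambda].

    All sublevel sets are replaced by their interiors: these are Borel, and
    the points lost lie in the boundary of [Om] or are discontinuities of
    [f], hence are negligible. *)

Set Implicit Arguments.
Unset Strict Implicit.

(** * Sup-norm topology of R^d and measurability of open sets *)

Section NearTopology.
Context {R : realType} {d : nat}.
Implicit Types (x y c : d.-tuple R) (A V Om : set (d.-tuple R)) (r : R).

(** The interior of [A], built on [near_pt] to match the definitions of boundary and continuity. *)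
Definition nint A := [set x | exists2 r : R, 0 < r & forall y, near_pt y x r -> A y].
Definition near_open V := V `<=` nint V.

Lemma near_pt_sym x y r : near_pt x y r -> near_pt y x r.
Proof. by move=> h j; rewrite distrC. Qed.

Lemma near_pt_trans y x z r s : near_pt x y r -> near_pt y z s -> near_pt x z (r + s).
Proof.
by move=> h1 h2 j; apply: le_lt_trans (ler_distD (tnth y j) _ _) _; exact: ltrD.
Qed.

Lemma near_pt_refl x r : 0 < r -> near_pt x x r.
Proof. by move=> r0 j; rewrite subrr normr0. Qed.

Lemma near_ptW x y r s : r <= s -> near_pt x y r -> near_pt x y s.
Proof. by move=> rs h j; apply: lt_le_trans rs. Qed.

Lemma nint_sub A : nint A `<=` A.
Proof. by move=> x [r r0]; apply; exact: near_pt_refl. Qed.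

Lemma near_open_nint A : near_open (nint A).
Proof.
move=> x [r r0 h]; exists (r / 2); first by rewrite divr_gt0.
move=> y yx; exists (r / 2); first by rewrite divr_gt0.
by move=> z zy; apply: h; rewrite [r]splitr; apply: near_pt_trans yx.
Qed.

Lemma measurable_near_pt c r : measurable [set y | near_pt y c r].
Proof.
have -> : [set y | near_pt y c r] =
    \bigcap_(j in [set: 'I_d])
      ((fun y : d.-tuple R => tnth y j) @^-1` `](tnth c j - r), (tnth c j + r)[%classic).
  apply/seteqP; split => [y h j _|y h j] /=.
    by have := h j; rewrite ltr_distl in_itv.
  by have := h j I; rewrite /= in_itv /= ltr_distl.
apply: fin_bigcap_measurable => // j _; rewrite -[X in measurable X]setTI.
exact: measurable_tnth.
Qed.

Lemma ratr_approx (u e : R) : 0 < e -> {q : rat | `|u - ratr q| < e}.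
Proof.
move=> e0; apply: cid.
have [|q] := @rat_in_itvoo R (u - e) (u + e); first by lra.
rewrite in_itv /= => h; exists q; rewrite distrC ltr_distl; lra.
Qed.

(** An open set is the union of the countably many boxes of rational centre and radius [1/(k+1)]
    that it contains. *)
Lemma near_open_measurable V : near_open V -> measurable V.
Proof.
move=> oV.
pose C (p : d.-tuple rat * nat) :=
  [set y : d.-tuple R | near_pt y [tuple of map ratr p.1] (p.2.+1%:R^-1)].
have -> : V = \bigcup_p (if `[< C p `<=` V >] then C p else set0).
  apply/seteqP; split => [x /oV[r r0 h]|x [p _]]; last by case: asboolP => // h /h.
  (* A box of radius below [r / 2] that contains [x] lies within [r] of [x]. *)
  have r20 : 0 < r / 2 by rewrite divr_gt0.
  have [k _ /(_ k (leqnn k)) /= hk] := near_infty_natSinv_lt (PosNum r20).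
  have k0 : 0 < k.+1%:R^-1 :> R by rewrite invr_gt0.
  pose q := [tuple sval (ratr_approx (tnth x j) k0) | j < d].
  have xq : C (q, k) x.
    move=> j; rewrite tnth_map tnth_mktuple.
    by case: ratr_approx.
  exists (q, k) => //; rewrite asboolT //= => y yq; apply: h.
  apply: near_ptW (near_pt_trans yq (near_pt_sym xq)); rewrite [leRHS]splitr; exact: lerD (ltW hk) (ltW hk).
apply: countable_bigcupT_measurable; first exact: countableP.
by move=> p; case: asboolP => // _; exact: measurable_near_pt.
Qed.

Lemma boundaryE Om x : ~ boundary Om x -> nint Om x \/ nint (~` Om) x.
Proof.
move=> /existsNP[r /not_implyP[r0 /not_andP[h|h]]]; [right|left]; exists r => // y yx.
  by move=> Oy; apply: h; exists y.
by apply: contrapT => nOy; apply: h; exists y.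
Qed.

End NearTopology.

(** * Cardinalities of finite sets of multi-indices *)

Section Counting.
Context {d : nat}.
Implicit Types A B C : set (d.-tuple nat).

Lemma card_set_le A B : finite_set B -> A `<=` B -> (card_set A <= card_set B)%N.
Proof.
move=> fB AB; apply: fsubset_leq_card.
by rewrite -fset_set_sub //; exact: sub_finite_set AB fB.
Qed.

Lemma card_set_disj A B C : finite_set C -> A `<=` C -> B `<=` C ->
  A `&` B = set0 -> (card_set A + card_set B <= card_set C)%N.
Proof.
move=> fC AC BC AB.
have fA : finite_set A by exact: sub_finite_set AC fC.
have fB : finite_set B by exact: sub_finite_set BC fC.
rewrite /card_set -cardfsUI -fset_setU // -fset_setI // AB fset_set0 cardfs0 addn0.
by apply: card_set_le => // i [/AC|/BC].
Qed.

Lemma card_set_bij A (s : d.-tuple nat -> d.-tuple nat) (P : set (d.-tuple nat)) :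
  finite_set A -> set_bij A A s ->
  card_set [set i | A i /\ P (s i)] = card_set [set i | A i /\ P i].
Proof.
move=> fA [sA injs surjs].
have sub (Q : set (d.-tuple nat)) : finite_set [set i | A i /\ Q i].
  by apply: sub_finite_set fA => i [].
have E : s @` [set i | A i /\ P (s i)] = [set i | A i /\ P i].
  apply/seteqP; split => [_ [i [Ai Pi] <-]|i [Ai Pi]]; first by split => //; exact: sA.
  by have [k Ak ki] := surjs i Ai; exists k => //; split => //; rewrite ki.
apply/esym/eqP; rewrite -E; apply/eqP/fcard_eq; [exact: finite_image|exact: sub|].
apply: inj_card_eq => i k; rewrite !inE => -[Ai _] [Ak _].
by apply: injs; rewrite inE.
Qed.

Lemma finite_mindex_box (n : d.-tuple nat) : finite_set (mindex_box n).
Proof.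
pose M := (\max_(j < d) tnth n j).+1.
have -> : mindex_box n = (fun t : d.-tuple 'I_M => [tuple nat_of_ord (tnth t j) | j < d]) @`
   ([set t | mindex_box n [tuple nat_of_ord (tnth t j) | j < d]]).
  apply/seteqP; split => [i hi|_ [t ht <-]] //.
  have lt j : (tnth i j < M)%N.
    by rewrite ltnS; apply: leq_trans (leq_bigmax j); have /andP[] := hi j.
  pose t := [tuple (Ordinal (lt j)) | j < d].
  have E : [tuple nat_of_ord (tnth t j) | j < d] = i by apply: eq_from_tnth => j; rewrite !tnth_mktuple.
  by exists t => //; rewrite /= E.
by apply: finite_image; exact: finite_finset.
Qed.

Lemma card_mindex_box (n : d.-tuple nat) : (card_set (mindex_box n) <= \prod_j tnth n j)%N.
Proof.
(* The successor turns ordinals, counted from 0, into coordinates counted from 1. *)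
pose h (t : {dffun forall j : 'I_d, 'I_(tnth n j)}) := [tuple (t j).+1 | j < d].
have sub : mindex_box n `<=` h @` setT.
  move=> i hi.
  have lt j : ((tnth i j).-1 < tnth n j)%N.
    by have /andP[h1 h2] := hi j; rewrite prednK.
  exists [ffun j => Ordinal (lt j)] => //.
  apply: eq_from_tnth => j; rewrite tnth_mktuple ffunE /= prednK //.
  by have /andP[] := hi j.
have -> : (\prod_j tnth n j)%N = #|{dffun forall j : 'I_d, 'I_(tnth n j)}|.
  by rewrite card_dep_ffun foldrE big_image /=; apply: eq_bigr => j _; rewrite card_ord.
rewrite cardE -(size_map h); apply: uniq_leq_size; first exact: fset_uniq.
move=> i; rewrite in_fset_set ?inE; last exact: finite_mindex_box.
by move=> /sub[t _ <-]; apply: map_f; rewrite mem_enum.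
Qed.

End Counting.

(** * Boxes and their subdivision into cells *)

Section Boxes.
Context {R : realType} {d : nat}.
Implicit Types (x y a b c : d.-tuple R) (U : set (d.-tuple R)) (r : R).

Definition cbox a b := [set y : d.-tuple R | forall j : 'I_d, tnth a j <= tnth y j <= tnth b j].

Lemma measurable_cbox a b : measurable (cbox a b).
Proof.
have -> : cbox a b =
    \bigcap_(j in [set: 'I_d])
      ((fun y : d.-tuple R => tnth y j) @^-1` `[(tnth a j), (tnth b j)]%classic).
  apply/seteqP; split => [y h j _|y h j] /=.
    by have := h j; rewrite in_itv.
  by have := h j I; rewrite /= in_itv.
apply: fin_bigcap_measurable => // j _; rewrite -[X in measurable X]setTI.
exact: measurable_tnth.
Qed.

Lemma near_open_ball c r : near_open [set y | near_pt y c r].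
Proof.
move=> y yc; exists (\big[Num.min/1]_(j < d) (r - `|tnth y j - tnth c j|)).
  by apply: lt_bigmin => // j _; rewrite subr_gt0.
move=> z zy j; apply: le_lt_trans (ler_distD (tnth y j) _ _) _.
rewrite -ltrBrDr; apply: lt_le_trans (zy j) _.
exact: bigmin_le_cond.
Qed.

(** The erosion of [U]. Its margin [r] absorbs both the cell size and the displacement of the grid
    points. *)
Definition shrink U r := [set y | forall z, near_pt z y r -> U z].

(** The complement is open: a point outside [U] at distance less than [r] from [y] is also that
    close to all points near [y]. *)
Lemma measurable_shrink U r : measurable (shrink U r).
Proof.
rewrite -[shrink U r]setCK; apply: measurableC; apply: near_open_measurable.
move=> y /existsNP[z /not_implyP[zy Uz]].
have [s s0 h] := near_open_ball (near_pt_sym zy).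
by exists s => // t /h tz /(_ z); apply: contra_not Uz; apply; exact: near_pt_sym.
Qed.

(** With [h] the step, [k] is the integer part of [(y - u) / h] plus one. *)
Lemma cell_coord (u v y : R) (n : nat) : u < v -> (0 < n)%N -> u <= y <= v ->
  exists k : nat, (1 <= k <= n)%N /\
   u + k.-1%:R * ((v - u) / n%:R) <= y <= u + k%:R * ((v - u) / n%:R).
Proof.
move=> uv n0 /andP[uy yv].
have nR : 0 < n%:R :> R by rewrite ltr0n.
have h0 : 0 < (v - u) / n%:R by rewrite divr_gt0 ?subr_gt0.
have hn : n%:R * ((v - u) / n%:R) = v - u by rewrite mulrC divfK // gt_eqF.
move: h0 hn; set h := (v - u) / n%:R => h0 hn.
(* At [y = v] that formula would give [n + 1], so [k = n] is taken there. *)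
move: yv; rewrite le_eqVlt => /predU1P[->|yv].
  exists n; rewrite n0 leqnn; split => //.
  have : n.-1%:R * h <= n%:R * h by rewrite ler_pM2r // ler_nat leq_pred.
  lra.
have w0 : 0 <= (y - u) / h by rewrite divr_ge0 ?subr_ge0 // ltW.
have /andP[k1 k2] := truncn_itv w0.
exists (Num.truncn ((y - u) / h)).+1; split.
  rewrite /= -(ltr_nat R); apply: le_lt_trans k1 _.
  rewrite ltr_pdivrMr // hn; lra.
move: k1 k2; rewrite ler_pdivlMr // ltr_pdivrMr //=; lra.
Qed.

(** The upper corner is the uniform grid point of index [i]. Neighbouring closed cells share faces,
    which is harmless for subadditivity. *)
Definition cell a b (n i : d.-tuple nat) :=
  cbox [tuple tnth a j + (tnth i j).-1%:R * ((tnth b j - tnth a j) / (tnth n j)%:R) | j < d]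
       [tuple tnth a j + (tnth i j)%:R * ((tnth b j - tnth a j) / (tnth n j)%:R) | j < d].

Lemma cell_cover a b (n : d.-tuple nat) y :
  (forall j, tnth a j < tnth b j) -> (forall j, (0 < tnth n j)%N) ->
  cbox a b y -> exists2 i, mindex_box n i & cell a b n i y.
Proof.
move=> ab n0 yab.
have h j := cid (cell_coord (ab j) (n0 j) (yab j)).
exists [tuple sval (h j) | j < d] => j; rewrite !tnth_mktuple.
  by have [] := svalP (h j).
by have [] := svalP (h j).
Qed.

End Boxes.

(** * Lower bound for the number of grid points in an open set *)

Section LebesgueGrid.
Context {R : realType} {d : nat}.
Variable mu : {measure set (d.-tuple R) -> \bar R}.
Hypothesis mu_leb : is_lebesgue_d mu.
Implicit Types (a b : d.-tuple R) (U : set (d.-tuple R)).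

Definition cell_vol a b (n : d.-tuple nat) : R :=
  \prod_(j < d) ((tnth b j - tnth a j) / (tnth n j)%:R).

Lemma measure_cell a b (n i : d.-tuple nat) :
  (forall j, tnth a j < tnth b j) -> mindex_box n i ->
  mu (cell a b n i) = (cell_vol a b n)%:E.
Proof.
move=> ab hi; rewrite mu_leb; congr EFin; apply: eq_bigr => j _.
rewrite !tnth_mktuple; have /andP[i1 i2] := hi j.
have h0 : 0 <= (tnth b j - tnth a j) / (tnth n j)%:R.
  by rewrite divr_ge0 ?subr_ge0 // ltW.
rewrite -[in X in X - _](prednK i1) [in X in X - _]mulrS.
by rewrite mulrDl mul1r opprD addrACA subrr add0r addrK max_r.
Qed.

(* For large [n], a cell of the partition of [a, b] that meets [shrink U r] has
   its grid point in [U]; such cells cover [shrink U r], so their number times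
   the cell volume is at least its measure. *)
Lemma grid_count_lower a b (N : nat -> d.-tuple nat) x U (e : R) :
  (forall j, tnth a j < tnth b j) -> mindex_to_infty N -> au_grid a b N x ->
  near_open U -> 0 < e ->
  \forall n \near \oo, fine (mu (U `&` cbox a b)) - e <
     (card_set [set i | mindex_box (N n) i /\ U (x n i)])%:R * cell_vol a b (N n).
Proof.
move=> ab Noo xab oU e0.
have mU := near_open_measurable oU.
have mc := measurable_cbox a b.
have cfin : (mu (cbox a b) < +oo)%E by rewrite mu_leb ltry.
(* As [U] is open, these erosions increase to its part in the box; by continuity from below one of
   them loses less than [e]. *)
pose A k := shrink U k.+1%:R^-1 `&` cbox a b.
have mA k : measurable (A k) by apply: measurableI => //; exact: measurable_shrink.
have AU : \bigcup_k A k = U `&` cbox a b.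
  apply/seteqP; split => [y [k _ [h yab]]|y [/oU[r r0 h] yab]].
    by split => //; apply: h; apply: near_pt_refl; rewrite invr_gt0.
  have [k _ /(_ k (leqnn k)) /= hk] := near_infty_natSinv_lt (PosNum r0).
  exists k => //; split => // z zy; apply: h; apply: near_ptW zy; exact: ltW.
have fin : mu (U `&` cbox a b) \is a fin_num.
  rewrite ge0_fin_numE //; apply: le_lt_trans cfin.
  by apply: le_measure; rewrite ?inE //; exact: measurableI.
have : mu (A k) @[k --> \oo] --> mu (U `&` cbox a b).
  rewrite -AU; apply: (@nondecreasing_cvg_mu _ _ _ mu A) => //.
    by rewrite AU; exact: measurableI.
  move=> k l kl; apply/subsetPset => y [h yab]; split => // z zy; apply: h.
  apply: near_ptW zy; rewrite lef_pV2 ?posrE ?ltr0n // ler_nat ltnS //.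
rewrite -(fineK fin) => /fine_cvg /cvgr_gt /(_ (fine (mu (U `&` cbox a b)) - e)).
move=> /(_ ltac:(lra)) [k _ /(_ k (leqnn k)) /= hk].
set r : R := k.+1%:R^-1; have r0 : 0 < r by rewrite invr_gt0.
have r4 : 0 < r / 4 by rewrite divr_gt0.
(* [L] bounds every side, so one threshold on the entries of [N n] makes all cell sides smaller than
   [r / 4]. *)
pose L := \sum_(j < d) (tnth b j - tnth a j).
have Lj j : tnth b j - tnth a j <= L.
  rewrite /L (bigD1 j) //= lerDl sumr_ge0 // => l _.
  by rewrite subr_ge0 ltW.
near=> n.
have Nn j : ((Num.truncn (L / (r / 4))).+1 <= tnth (N n) j)%N.
  by move: j; near: n; exact: Noo.
have grid i : mindex_box (N n) i -> forall j : 'I_d,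
    `|tnth (x n i) j - (tnth a j + (tnth i j)%:R * (tnth b j - tnth a j) / (tnth (N n) j)%:R)|
      <= r / 4.
  by move: i; near: n; exact: xab.
have hj j : (tnth b j - tnth a j) / (tnth (N n) j)%:R < r / 4.
  have Nj0 : 0 < (tnth (N n) j)%:R :> R by rewrite ltr0n (leq_trans _ (Nn j)).
  rewrite ltr_pdivrMr // mulrC -ltr_pdivrMr //.
  apply: le_lt_trans (_ : L / (r / 4) < _).
    by rewrite ler_pM2r ?invr_gt0.
  apply: lt_le_trans (_ : (Num.truncn (L / (r / 4))).+1%:R <= _); last by rewrite ler_nat.
  have L0 : 0 <= L by apply: le_trans (Lj j); rewrite subr_ge0 ltW.
  by have /andP[] := truncn_itv (divr_ge0 L0 (ltW r4)).
apply: lt_le_trans hk _.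
set J := [set i | _].
have fJ : finite_set J by apply: sub_finite_set (finite_mindex_box (N n)) => i [].
(* Coordinatewise, [y] is within one cell side of the upper corner of its cell, and the grid point
   within [r / 4] of that corner; so they are less than [r / 2] apart. *)
have cov : A k `<=` \bigcup_(i in J) cell a b (N n) i.
  move=> y [Uy yab].
  have n0 j : (0 < tnth (N n) j)%N by exact: leq_trans (Nn j).
  have [i iN yi] := cell_cover ab n0 yab.
  exists i => //; split => //; apply: Uy; rewrite -/r => j.
  have /andP[i1 i2] := iN j.
  have := yi j; rewrite !tnth_mktuple => /andP[y1 y2].
  have := grid i iN j; have := hj j.
  have E : (tnth i j)%:R = (tnth i j).-1%:R + 1 :> R by rewrite natr1 prednK.
  move: y1 y2; rewrite -mulrA E; set h := (_ - _) / _.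
  rewrite mulrDl mul1r; set q := _ * h => y1 y2 hr.
  rewrite ler_distl ltr_distl => /andP[x1 x2].
  by apply/andP; split; lra.
have := @content_sub_fsum _ _ _ mu _ J (A k) (cell a b (N n)) fJ
  (fun i _ => measurable_cbox _ _) (mA k) cov.
rewrite (eq_fsbigr (fun=> (cell_vol a b (N n))%:E)); last first.
  by move=> i; rewrite inE => -[iN _]; exact: measure_cell.
have finA : mu (A k) \is a fin_num.
  rewrite ge0_fin_numE //; apply: le_lt_trans cfin.
  by apply: le_measure; rewrite ?inE // => y [].
rewrite fsbig_finite //= sumEFin big_const_seq count_predT iter_addr_0.
by rewrite -[in X in (X <= _)%E -> _](fineK finA) lee_fin -[in leRHS]mulr_natl.
Unshelve. all: by end_near.
Qed.

End LebesgueGrid.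

(** * A continuous cutoff of bounded support *)

Section Trapezoid.
Context {R : realType}.
Implicit Types t s L : R.

(** For [L <= t < s]: equal to 1 on [[L, t]], with linear ramps down to 0 at [L - 1] and at [s]. The
    left ramp gives the bounded support required of test functions; it costs nothing when all values
    are at least [L]. *)
Definition trapezoid L t s : R -> R :=
  (cst 0 \max (cst 1 \min
    ((fun y => (s - t)^-1 * (s - y)) \min (fun y => y - L + 1)))).

Lemma trapezoid_ge0 L t s y : 0 <= trapezoid L t s y.
Proof. by rewrite /trapezoid /= le_max lexx. Qed.

Lemma trapezoid_le1 L t s y : trapezoid L t s y <= 1.
Proof. by rewrite /trapezoid /= ge_max ler01 ge_min lexx. Qed.

Lemma trapezoid_eq0 L t s y : t < s -> (s <= y) || (y <= L - 1) -> trapezoid L t s y = 0.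
Proof.
move=> ts h; apply/eqP; rewrite eq_le trapezoid_ge0 andbT /trapezoid /=.
rewrite ge_max lexx /= !ge_min; case/orP: h => h.
  by rewrite pmulr_rle0 ?invr_gt0 ?subr_gt0 // subr_le0 h orbT.
by rewrite (_ : y - L + 1 <= 0) ?orbT //; lra.
Qed.

Lemma trapezoid_eq1 L t s y : t < s -> L <= y <= t -> trapezoid L t s y = 1.
Proof.
move=> ts /andP[Ly yt]; apply/eqP; rewrite eq_le trapezoid_le1 /= /trapezoid /=.
rewrite le_max !le_min lexx /=; apply/orP; right; apply/andP; split; last by lra.
by rewrite mulrC ler_pdivlMr ?subr_gt0 // mul1r lerD2l lerN2.
Qed.

Lemma trapezoid_continuous L t s : continuous (trapezoid L t s).
Proof.
move=> y; apply: continuous_max; first exact: cvg_cst.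
apply: continuous_min; first exact: cvg_cst.
apply: continuous_min; apply: differentiable_continuous.
  by [].
by [].
Qed.

End Trapezoid.

(** * Outer measure and negligible sets *)

Section OuterMeasure.
Context {R : realType} {d : nat}.
Variable mu : {measure set (d.-tuple R) -> \bar R}.
Implicit Types A B Om : set (d.-tuple R).

Lemma muo_le A B : measurable B -> A `<=` B -> (muo mu A <= mu B)%E.
Proof. by move=> mB AB; apply: ereal_inf_lbound; exists B. Qed.

Lemma le_muo A B : measurable A -> A `<=` B -> (mu A <= muo mu B)%E.
Proof.
move=> mA AB; apply: le_ereal_inf_tmp => _ [C [mC BC] <-].
by apply: le_measure; rewrite ?inE //; exact: subset_trans BC.
Qed.

(** Negligible sets need not be Borel, so they are always handled through a Borel cover of small
    measure; here each set gets one of measure below [e / 2]. *)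
Lemma muoU_eq0 A B (e : R) : muo mu A = 0%E -> muo mu B = 0%E -> 0 < e ->
  exists C, [/\ measurable C, A `|` B `<=` C & (mu C <= e%:E)%E].
Proof.
move=> A0 B0 e0; have e2 : (0 < (e / 2)%:E)%E by rewrite lte_fin divr_gt0.
have := e2; rewrite -{1}A0 => /ereal_inf_lt[_ [C1 [m1 s1] <-] h1].
have := e2; rewrite -{1}B0 => /ereal_inf_lt[_ [C2 [m2 s2] <-] h2].
exists (C1 `|` C2); split; [exact: measurableU|exact: setUSS|].
apply: le_trans (measureU2 _ m1 m2) _.
by rewrite [e]splitr EFinD; apply: leeD; exact: ltW.
Qed.

End OuterMeasure.

(** * Measures of the interiors of sublevel sets *)

Section SubLevel.
Context {R : realType} {d : nat}.
Variables (mu : {measure set (d.-tuple R) -> \bar R}) (Om : set (d.-tuple R)).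
Variables (f : d.-tuple R -> R) (a b : d.-tuple R).
Hypothesis mu_leb : is_lebesgue_d mu.
Hypothesis Om_reg : regular mu Om.
Hypothesis f_cont : ae_continuous mu Om f.
Hypothesis Om_box : Om `<=` cbox a b.

Definition osublevel s := nint [set y | Om y /\ f y < s].

Lemma measurable_osublevel s : measurable (osublevel s).
Proof. by apply: near_open_measurable; exact: near_open_nint. Qed.

Lemma measure_fin_num A : measurable A -> A `<=` Om -> mu A \is a fin_num.
Proof.
move=> mA AOm; rewrite ge0_fin_numE //.
apply: (@le_lt_trans _ _ (mu (cbox a b))); last by rewrite mu_leb ltry.
apply: le_measure; rewrite ?inE //; first exact: measurable_cbox.
exact: subset_trans Om_box.
Qed.

Lemma osublevel_fin_num s : mu (osublevel s) \is a fin_num.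
Proof.
apply: measure_fin_num; first exact: measurable_osublevel.
by move=> y /nint_sub[].
Qed.

Lemma good_point y : Om y -> ~ boundary Om y -> nint Om y.
Proof. by move=> Oy /boundaryE[//|/nint_sub]. Qed.

(* Neither [Om] nor [f] need be Borel: the integral of a nonnegative function is
   the supremum over the simple functions below it, and these are all bounded
   by the indicator of [osublevel s] together with a set of measure [e]. *)
Lemma Rintegral_osublevel (F : R -> R) s :
  (forall y, 0 <= F y <= 1) -> (forall y, s <= y -> F y = 0) ->
  Rintegral mu Om (F \o f) <= fine (mu (osublevel s)).
Proof.
move=> F01 Fs; rewrite /Rintegral.
have F0 y : (0 <= ((F \o f) y)%:E)%E by rewrite lee_fin; have /andP[] := F01 (f y).
have mS := measurable_osublevel s.
have le : (\int[mu]_(x in Om) ((F \o f) x)%:E <= mu (osublevel s))%E.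
  rewrite ge0_integralE //; apply: ge_ereal_sup => _ [h /= hF <-].
  apply/lee_addgt0Pr => e e0.
  have [C [mC sC Ce]] := muoU_eq0 Om_reg.2 f_cont e0.
  apply: (@le_trans _ _ (mu (osublevel s) + mu C)%E); last exact: leeD.
  apply: (@le_trans _ _ (mu (osublevel s `|` C))); last exact: measureU2.
  have mSC := measurableU _ _ mS mC.
  have <- : sintegral mu (\1_(osublevel s `|` C) : _ -> R) = mu (osublevel s `|` C).
    exact: sintegral_indic.
  apply: (@le_sintegral _ _ _ mu h (indic_nnsfun R mSC)) => y /=.
  rewrite -[leRHS]/(\1_(osublevel s `|` C) y) indicE; have := hF y; rewrite /patch.
  case: ifPn => [|_]; last by rewrite lee_fin => /le_trans; apply.
  rewrite inE => Oy; rewrite lee_fin => /le_trans; apply.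
  have /andP[_ F1] := F01 (f y).
  have [//|ySC] := boolP (y \in _).
  have [fs|fs] := leP s (f y); first by rewrite Fs.
  (* Outside [C] the point [y] is interior to [Om] and a continuity point of [f], so [f y < s] puts
     it in [osublevel s]. *)
  exfalso; move: ySC; rewrite notin_setE => /not_orP[+ yC]; apply.
  have [|r1 r10 h1] := good_point Oy; first by move=> By; apply: yC; apply: sC; left.
  have [cy|cy] := pselect (cont_at_within Om f y); last by exfalso; apply: yC; apply: sC; right.
  have [|r2 r20 h2] := cy (s - f y); first by rewrite subr_gt0.
  exists (Num.min r1 r2); first by rewrite lt_min r10.
  move=> z zy; have Oz : Om z by apply: h1; apply: near_ptW zy; rewrite ge_min lexx.
  split => //; have := h2 z Oz; rewrite ltr_distl.
  have zr2 : near_pt z y r2 by apply: near_ptW zy; rewrite ge_min lexx orbT.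
  by move=> /(_ zr2) /andP[_]; lra.
apply: fine_le => //; last exact: osublevel_fin_num.
rewrite ge0_fin_numE; last exact: integral_ge0.
by apply: le_lt_trans le _; rewrite -ge0_fin_numE // osublevel_fin_num.
Qed.

(** Values near [z] are taken on a set of positive outer measure, hence at a continuity point [p]
    interior to [Om]. A small box around [p] then lies in the larger set and misses the smaller
    one. *)
Lemma osublevel_lt s1 s2 z : s1 < z < s2 -> ess_range mu Om f z ->
  fine (mu (osublevel s1)) < fine (mu (osublevel s2)).
Proof.
move=> /andP[s1z zs2] zf.
have e0 : 0 < Num.min (z - s1) (s2 - z) by rewrite lt_min !subr_gt0 s1z.
have := zf _ e0; set e := Num.min _ _; set S := [set _ | _] => S0.
have [p [Op pe] pnb] : exists2 p, S p & ~ (boundary Om `|` [set x | Om x /\ ~ cont_at_within Om f x]) p.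
  apply: contrapT => h; move: S0; apply/negP; rewrite -leNgt.
  apply/lee_addgt0Pr => r r0; rewrite add0e.
  have [C [mC sC Ce]] := muoU_eq0 Om_reg.2 f_cont r0.
  apply: le_trans Ce; apply: muo_le => // p Sp; apply: sC.
  by apply: contrapT => np; apply: h; exists p.
have [|r1 r10 h1] := good_point Op; first by move=> Bp; apply: pnb; left.
have cp : cont_at_within Om f p.
  by apply: contrapT => cp; apply: pnb; right.
(* This tolerance keeps [f] within [e] of [z], hence strictly between [s1] and [s2], near [p]. *)
have [|r2 r20 h2] := cp (e - `|f p - z|); first by rewrite subr_gt0.
pose r := Num.min r1 r2.
have r0 : 0 < r by rewrite lt_min r10.
have hr y : near_pt y p r -> Om y /\ s1 < f y < s2.
  move=> yp.
  have Oy : Om y by apply: h1; apply: near_ptW yp; rewrite ge_min lexx.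
  split => //.
  have := h2 y Oy; have yr2 : near_pt y p r2 by apply: near_ptW yp; rewrite ge_min lexx orbT.
  move=> /(_ yr2); rewrite ltrBrDr => /(le_lt_trans (ler_distD (f p) _ _)).
  by rewrite lt_min !ltr_distl => /andP[/andP[? ?] /andP[? ?]]; apply/andP; split; lra.
(* Points of [Q] are within [r / 2] of [p], so their own [r / 2]-neighbourhoods stay within [r] of
   [p]: [Q] lies in the interior. *)
pose Q := cbox [tuple tnth p j - r / 4 | j < d] [tuple tnth p j + r / 4 | j < d].
have mQ : measurable Q by exact: measurable_cbox.
have Qp y : Q y -> near_pt y p (r / 2).
  by move=> h j; have := h j; rewrite !tnth_mktuple ltr_distl => /andP[? ?]; apply/andP; split; lra.
have Q0 : (0 < mu Q)%E.
  rewrite mu_leb lte_fin; apply: prodr_gt0 => j _; rewrite !tnth_mktuple lt_max.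
  by apply/orP; right; lra.
have sub : osublevel s1 `|` Q `<=` osublevel s2.
  move=> y [[u u0 h]|/Qp Qy].
    by exists u => // w /h[? ?]; split => //; lra.
  exists (r / 2); first by lra.
  move=> w wy; have [|Ow /andP[_ ?]] := hr w; last by [].
  by rewrite [r]splitr; exact: near_pt_trans wy Qy.
have dis : osublevel s1 `&` Q = set0.
  apply/seteqP; split => // y [/nint_sub[_ fy] /Qp Qy].
  by have [|_ /andP[]] := hr y; [apply: near_ptW Qy; lra|lra].
have mS := measurable_osublevel s1.
have finQ : mu Q \is a fin_num.
  by rewrite ge0_fin_numE // mu_leb ltry.
have : (mu (osublevel s1 `|` Q) <= mu (osublevel s2))%E.
  by apply: le_measure; rewrite ?inE //; [exact: measurableU|exact: measurable_osublevel].
rewrite measureU // => /fine_le; rewrite fin_numD !osublevel_fin_num finQ => /(_ isT isT).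
rewrite fineD // ?osublevel_fin_num //; apply: lt_le_trans; rewrite ltrDl.
by rewrite fine_gt0 // Q0 -ge0_fin_numE.
Qed.

End SubLevel.

(** Markov's inequality for counting: [G] dominates the indicator of [P] on [A]. *)
Lemma card_set_le_sum {R : realType} {d : nat} (A P : set (d.-tuple nat)) (G : d.-tuple nat -> R) :
  finite_set A -> (forall i, A i -> 0 <= G i) -> (forall i, A i -> P i -> 1 <= G i) ->
  (card_set [set i | A i /\ P i])%:R <= \sum_(i <- fset_set A) G i.
Proof.
move=> fA G0 G1.
have fP : finite_set [set i | A i /\ P i] by apply: sub_finite_set fA => i [].
have -> : card_set [set i | A i /\ P i] = size [seq i <- fset_set A | `[< P i >]].
  apply: perm_size; apply: uniq_perm; [exact: fset_uniq|exact/filter_uniq/fset_uniq|].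
  move=> i; rewrite mem_filter !in_fset_set // andbC.
  apply/idP/andP => [/set_mem[Ai Pi]|[/set_mem Ai /asboolP Pi]]; last exact: mem_set.
  by split; [exact: mem_set|exact/asboolP].
rewrite (bigID (fun i => `[< P i >])) /= -[leLHS]addr0; apply: lerD.
  rewrite -sum1_size natr_sum big_filter big_seq_cond [leRHS]big_seq_cond.
  apply: ler_sum => i; rewrite in_fset_set // => /andP[/set_mem Ai /asboolP Pi].
  exact: G1.
rewrite big_seq_cond; apply: sumr_ge0 => i; rewrite in_fset_set // => /andP[/set_mem Ai _].
exact: G0.
Qed.

(** * Asymptotic counts of samples and of [lambda] values *)

Section GridCounts.
Context {R : realType} {d : nat}.
Variables (mu : {measure set (d.-tuple R) -> \bar R}) (Om : set (d.-tuple R)).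
Variables (a b : d.-tuple R) (N : nat -> d.-tuple nat).
Variable x : nat -> d.-tuple nat -> d.-tuple R.
Hypothesis mu_leb : is_lebesgue_d mu.
Hypothesis Om_reg : regular mu Om.
Hypothesis Om_pos : (0 < muo mu Om)%E.
Hypothesis Om_box : Om `<=` cbox a b.
Hypothesis N_oo : mindex_to_infty N.
Hypothesis x_au : au_grid a b N x.

Lemma muo_fin_num : muo mu Om \is a fin_num.
Proof.
rewrite ge0_fin_numE; last exact: ltW.
apply: (@le_lt_trans _ _ (mu (cbox a b))); last by rewrite mu_leb ltry.
by apply: muo_le => //; exact: measurable_cbox.
Qed.

(** A degenerate side would give the box, and with it [Om], measure zero. *)
Lemma box_nondegenerate (j : 'I_d) : tnth a j < tnth b j.
Proof.
rewrite ltNge; apply/negP => ba; move: Om_pos; apply/negP; rewrite -leNgt.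
apply: le_trans (muo_le mu (measurable_cbox a b) Om_box) _.
by rewrite mu_leb (bigD1 j) //= max_l ?mul0r // subr_le0.
Qed.

(* Obtained from the lower bound for the exterior of [Om]. *)
Lemma grid_index_card_upper (e : R) : 0 < e -> \forall n \near \oo,
  (card_set [set i | mindex_box (N n) i /\ Om (x n i)])%:R * cell_vol a b (N n)
    < fine (muo mu Om) + e.
Proof.
move=> e0; have ab := box_nondegenerate.
pose V := nint (~` Om).
have mV : measurable V by apply: near_open_measurable; exact: near_open_nint.
have mO : measurable (nint Om) by apply: near_open_measurable; exact: near_open_nint.
have mB : measurable (cbox a b) by exact: measurable_cbox.
pose vol : R := \prod_(j < d) (tnth b j - tnth a j).
have volE : mu (cbox a b) = vol%:E.
  rewrite mu_leb; congr EFin; apply: eq_bigr => j _; rewrite max_r //.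
  by rewrite subr_ge0 ltW.
have finV : mu (V `&` cbox a b) \is a fin_num.
  rewrite ge0_fin_numE //; apply: (@le_lt_trans _ _ (mu (cbox a b))); last by rewrite volE ltry.
  by apply: le_measure; rewrite ?inE //; exact: measurableI.
(* The box is covered by the exterior of [Om], its interior and a small Borel cover of the
   boundary. *)
have vol_le : vol <= fine (mu (V `&` cbox a b)) + fine (muo mu Om).
  rewrite -lee_fin EFinD !fineK ?muo_fin_num //; apply/lee_addgt0Pr => r r0.
  have [C [mC sC Cr]] := muoU_eq0 Om_reg.2 Om_reg.2 r0.
  rewrite -volE; apply: (@le_trans _ _ (mu ((V `&` cbox a b) `|` nint Om `|` C))).
    apply: le_measure; rewrite ?inE //.
      by apply: measurableU => //; apply: measurableU => //; exact: measurableI.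
    move=> y yab; have [By|/boundaryE[|]] := pselect (boundary Om y).
    - by right; apply: sC; left.
    - by left; right.
    - by left; left.
  apply: (@le_trans _ _ (mu ((V `&` cbox a b) `|` nint Om) + mu C)%E).
    by apply: measureU2 => //; apply: measurableU => //; exact: measurableI.
  apply: leeD => //; apply: (@le_trans _ _ (mu (V `&` cbox a b) + mu (nint Om))%E).
    by apply: measureU2 => //; exact: measurableI.
  by apply: leeD => //; apply: le_muo => //; exact: nint_sub.
near=> n.
have n0 j : (0 < tnth (N n) j)%N by move: j; near: n; exact: N_oo.
have VN : fine (mu (V `&` cbox a b)) - e <
    (card_set [set i | mindex_box (N n) i /\ V (x n i)])%:R * cell_vol a b (N n).
  by near: n; apply: (grid_count_lower mu_leb ab N_oo x_au) => //; exact: near_open_nint.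
have w0 : 0 <= cell_vol a b (N n).
  by apply: prodr_ge0 => j _; rewrite divr_ge0 // subr_ge0 ltW.
have tot : (\prod_j tnth (N n) j)%:R * cell_vol a b (N n) = vol.
  rewrite /cell_vol prodf_div natr_prod mulrC divfK // gt_eqF // prodr_gt0 // => j _.
  by rewrite ltr0n.
(* No index counts for both [Om] and its exterior, and all the cells together have volume [vol]; so
   the lower bound for the exterior is an upper bound for [Om]. *)
have : (card_set [set i | mindex_box (N n) i /\ Om (x n i)] +
    card_set [set i | mindex_box (N n) i /\ V (x n i)] <= \prod_j tnth (N n) j)%N.
  apply: leq_trans (card_mindex_box _); apply: card_set_disj; [exact: finite_mindex_box| | |].
  - by move=> i [].
  - by move=> i [].
  - by apply/seteqP; split => // i [[_ Oi] [_ /nint_sub]].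
rewrite -(ler_nat R) natrD => /(ler_wpM2r w0); rewrite tot mulrDl.
lra.
Unshelve. all: by end_near.
Qed.

(** Both counts are multiplied by the cell volume: the first product is then at most about [u1], the
    second at least about [u2]. *)
Lemma count_below_lt (f : d.-tuple R -> R) (lam : nat -> d.-tuple nat -> R) (t h L : R) :
  let I := fun n => [set i | mindex_box (N n) i /\ Om (x n i)] in
  ae_continuous mu Om f -> asymp_distr mu I lam Om f ->
  (\forall n \near \oo, forall i, I n i -> L <= lam n i) ->
  0 < h -> ess_range mu Om f (t + h) ->
  \forall n \near \oo, (card_set [set i | I n i /\ (lam n i <= t)%R] <
                  card_set [set i | I n i /\ (f (x n i) < t + 2 * h)%R])%N.
Proof.
move=> I f_cont [Ioo lamF] lamL h0 zf.
have ab := box_nondegenerate.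
(* The essential value [t + h] lies strictly between [s1] and [s2], and the cutoff has room to
   descend between [t] and [s1]. *)
pose s1 := t + h / 2; pose s2 := t + 2 * h.
have ts1 : t < s1 by rewrite /s1; lra.
pose F := trapezoid L t s1.
pose u1 := fine (mu (osublevel Om f s1)).
pose u2 := fine (mu (osublevel Om f s2)).
have u12 : u1 < u2.
  apply: (@osublevel_lt _ _ mu Om f a b mu_leb Om_reg f_cont Om_box s1 s2 (t + h)) => //.
  by rewrite /s1 /s2; apply/andP; split; lra.
have u1_ge0 : 0 <= u1 by exact: fine_ge0.
pose M := fine (muo mu Om).
have M0 : 0 < M by rewrite fine_gt0 // Om_pos -ge0_fin_numE ?muo_fin_num // ltW.
have Fu : M^-1 * Rintegral mu Om (F \o f) <= u1 / M.
  rewrite mulrC ler_pM2r ?invr_gt0 //.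
  apply: (Rintegral_osublevel mu_leb Om_reg f_cont Om_box) => y.
    by rewrite trapezoid_ge0 trapezoid_le1.
  by move=> sy; apply: trapezoid_eq0 => //; rewrite sy.
(* Since [e <= 1], the product [(u1 / M + e) * (M + e)] exceeds [u1] by at most [e * D], hence by at
   most a quarter of [u2 - u1]. *)
pose D := M + u1 / M + 1.
have D0 : 0 < D by rewrite /D ltr_wpDl // addr_ge0 // ?divr_ge0 // ltW.
pose e := Num.min 1 ((u2 - u1) / 4 / D).
have e0 : 0 < e by rewrite /e lt_min ltr01 /= !divr_gt0 // subr_gt0.
have e1 : e <= 1 by rewrite /e ge_min lexx.
have eD : e * D <= (u2 - u1) / 4 by rewrite -ler_pdivlMr // /e ge_min lexx orbT.
have contF : continuous F by exact: trapezoid_continuous.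
have suppF : exists M : R, forall y, M < `|y| -> F y = 0.
  exists (`|s1| + `|L - 1|) => y hy; apply: trapezoid_eq0 => //.
  apply/orP; have [//|ys] := leP s1 y; [by left|right].
  have := ler_norm s1; have := ler_norm (- (L - 1)); rewrite normrN.
  have := normr_ge0 s1; have := normr_ge0 (L - 1).
  by move: hy; case: (ger0P y); lra.
have B := lamF F contF suppF.
have u1e : M^-1 * Rintegral mu Om (F \o f) < u1 / M + e by lra.
near=> n.
have K0 : 0 < (card_set (I n))%:R :> R.
  apply: (@lt_le_trans _ _ 1) => //; near: n.
  by move/cvgryPge: Ioo; exact.
have Bn : (card_set (I n))%:R^-1 * \sum_(i <- fset_set (I n)) F (lam n i) < u1 / M + e.
  by near: n; exact: cvgr_lt B _ u1e.
have Kn : (card_set (I n))%:R * cell_vol a b (N n) < M + e.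
  by near: n; exact: grid_index_card_upper.
have Un : fine (mu (osublevel Om f s2 `&` cbox a b)) - (u2 - u1) / 4 <
    (card_set [set i | mindex_box (N n) i /\ osublevel Om f s2 (x n i)])%:R * cell_vol a b (N n).
  near: n; apply: (grid_count_lower mu_leb ab N_oo x_au); first exact: near_open_nint.
  by rewrite divr_gt0 // subr_gt0.
have lamn : forall i, I n i -> L <= lam n i by near: n.
have n0 j : (0 < tnth (N n) j)%N by move: j; near: n; exact: N_oo.
have w0 : 0 < cell_vol a b (N n).
  by apply: prodr_gt0 => j _; rewrite divr_gt0 ?ltr0n // subr_gt0.
have finI : finite_set (I n) by apply: sub_finite_set (finite_mindex_box (N n)) => i [].
have An : (card_set [set i | I n i /\ lam n i <= t])%:R <=
    \sum_(i <- fset_set (I n)) F (lam n i).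
  apply: (@card_set_le_sum _ _ (I n) [set i | lam n i <= t]) => // i Ii.
    exact: trapezoid_ge0.
  by move=> /= it; rewrite /F trapezoid_eq1 // lamn.
have Cn : (card_set [set i | mindex_box (N n) i /\ osublevel Om f s2 (x n i)] <=
   card_set [set i | I n i /\ (f (x n i) < t + 2 * h)%R])%N.
  apply: card_set_le; first by apply: sub_finite_set finI => i [].
  by move=> i [iN /nint_sub[Oi fi]].
have subs2 : osublevel Om f s2 `&` cbox a b = osublevel Om f s2.
  by apply: setIidl => y /nint_sub[/Om_box].
move: Un; rewrite subs2 -/u2 => Un.
rewrite -(ltr_nat R) -(ltr_pM2r w0).
(* The separating value: a quarter of the gap is spent on each side. *)
apply: (@lt_le_trans _ _ (u2 - (u2 - u1) / 4)); last first.
  apply: le_trans (ltW Un) _; apply: ler_wpM2r; [exact: ltW|by rewrite ler_nat].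
move: Bn; rewrite mulrC ltr_pdivrMr // => Bn.
have := le_lt_trans An Bn; rewrite -(ltr_pM2r w0) => /lt_le_trans; apply.
rewrite -mulrA; set q := _ * cell_vol _ _ _ in Kn *.
have c0 : 0 <= u1 / M by rewrite divr_ge0 // ltW.
have cM : u1 / M * M = u1 by rewrite divfK // gt_eqF.
apply: (@le_trans _ _ ((u1 / M + e) * (M + e))).
  by apply: ler_wpM2l; [rewrite addr_ge0 // ltW|exact: ltW].
move: eD; rewrite /D; move: c0 cM; set c := u1 / M => c0 cM.
have ee : e * e <= e by rewrite -[leRHS]mulr1 ler_wpM2l // ltW.
have -> : (c + e) * (M + e) = c * M + e * c + e * M + e * e by ring.
rewrite !mulrDr mulr1 cM; lra.
Unshelve. all: by end_near.
Qed.

End GridCounts.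

(** * Maximal deviation and sorting *)

Section MaxDev.
Context {R : realType} {d : nat}.
Implicit Types (A : set (d.-tuple nat)) (g h : d.-tuple nat -> R).

Lemma max_dev_ge0 A g h : 0 <= max_dev A g h.
Proof. exact: bigmax_ge_id. Qed.

(** The bound [0 <= e] takes care of the default value 0 of the maximum. *)
Lemma max_dev_le A g h (e : R) : finite_set A -> 0 <= e ->
  (forall i, A i -> `|g i - h i| <= e) -> max_dev A g h <= e.
Proof.
move=> fA e0 gh; rewrite /max_dev big_seq; apply: (big_ind (fun v => v <= e)) => //.
  by move=> u v ue ve; rewrite ge_max ue.
by move=> i; rewrite in_fset_set // => /set_mem /gh.
Qed.

(** The first coordinate at which two distinct indices differ decides. *)
Lemma lexlt_total (i k : d.-tuple nat) : i = k \/ lexlt i k \/ lexlt k i.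
Proof.
have [->|ik] := eqVneq i k; [by left|right].
have ex : exists m, [exists j : 'I_d, (val j == m) && (tnth i j != tnth k j)].
  apply: contrapT => h; move/eqP: ik; apply; apply: eq_from_tnth => j.
  apply/eqP/negPn/negP => ikj; apply: h; exists (val j); apply/existsP; exists j.
  by rewrite eqxx.
case: (ex_minnP ex) => m /existsP[j /andP[/eqP jm ikj]] jmin.
have eq_before (l : 'I_d) : (l < j)%N -> tnth i l = tnth k l.
  move=> lj; apply/eqP/negPn/negP => ikl.
  suff : (m <= l)%N by rewrite leqNgt -jm lj.
  by apply: jmin; apply/existsP; exists l; rewrite eqxx.
case: (ltngtP (tnth i j) (tnth k j)) ikj => // h _; [left|right]; exists j; split => // l lj.
by rewrite eq_before.
Qed.

(* [tau] pairs the values of [g] and [h] of equal rank, and [lt] is an order of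
   [A] that sorts [g]; so the unsorted comparison is the sorted one with the
   identity as the permutation of the samples. *)
Lemma sorted_pairing A g h : finite_set A -> exists tau (lt : d.-tuple nat -> d.-tuple nat -> Prop),
  [/\ set_bij A A tau,
      forall i k, A i -> A k -> i = k \/ lt i k \/ lt k i,
      forall i k, A i -> A k -> lt i k -> g i <= g k &
      forall i k, A i -> A k -> lt i k -> h (tau i) <= h (tau k)].
Proof.
move=> fA.
pose sg := sort (relpre g <=%R) (fset_set A); pose sh := sort (relpre h <=%R) (fset_set A).
have memg i : (i \in sg) = (i \in A) by rewrite mem_sort in_fset_set.
have memh i : (i \in sh) = (i \in A) by rewrite mem_sort in_fset_set.
have sz : size sg = size sh by rewrite !size_sort.
have ug : uniq sg by rewrite sort_uniq fset_uniq.
have uh : uniq sh by rewrite sort_uniq fset_uniq.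
have idx i : A i -> (index i sg < size sg)%N by move=> Ai; rewrite index_mem memg; exact: mem_set.
have idx_inj i k : A i -> A k -> index i sg = index k sg -> i = k.
  by move=> Ai Ak; apply: (index_inj i); rewrite memg mem_set.
have sorted_le (s : d.-tuple nat -> R) i0 m n : let ss := sort (relpre s <=%R) (fset_set A) in
    (m < n)%N -> (n < size ss)%N -> s (nth i0 ss m) <= s (nth i0 ss n).
  move=> ss mn ns.
  have := @sorted_ltn_nth _ (relpre s <=%R) _ i0 ss _ m n.
  apply => //; first by move=> u v w /=; exact: le_trans.
  - by apply: sort_sorted => u v /=; exact: le_total.
  - by rewrite inE (ltn_trans mn).
pose tau i := nth i sh (index i sg).
(* Comparing ranks rather than values of [g] breaks ties, which makes the order total on [A]. *)
exists tau, (fun i k => (index i sg < index k sg)%N); split.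
- split.
  + by move=> i Ai; apply: set_mem; rewrite -memh mem_nth // -sz idx.
  + move=> i k /set_mem Ai /set_mem Ak; rewrite /tau (set_nth_default k) -?sz ?idx //.
    by move/eqP; rewrite nth_uniq -?sz ?idx // => /eqP; exact: idx_inj.
  + move=> k Ak; have kh : (index k sh < size sg)%N by rewrite sz index_mem memh mem_set.
    exists (nth k sg (index k sh)); first by apply: set_mem; rewrite -memg mem_nth.
    by rewrite /tau index_uniq // nth_index ?memh ?mem_set.
- move=> i k Ai Ak; case: (ltngtP (index i sg) (index k sg)) => [||E]; [by right; left|by right; right|left].
  exact: idx_inj.
- move=> i k Ai Ak ik; have := sorted_le g i _ _ ik (idx _ Ak).
  by rewrite !nth_index // memg mem_set.
- move=> i k Ai Ak ik; rewrite /tau (set_nth_default k i) -?sz ?idx //.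
  by apply: sorted_le => //; rewrite -/sh -sz idx.
Qed.

End MaxDev.

(** * Comparison of the sorted vectors *)

Section SortedComparison.
Context {R : realType} {d : nat}.
Variables (mu : {measure set (d.-tuple R) -> \bar R}) (Om : set (d.-tuple R)).
Variables (a b : d.-tuple R) (N : nat -> d.-tuple nat).
Variable x : nat -> d.-tuple nat -> d.-tuple R.
Hypothesis mu_leb : is_lebesgue_d mu.
Hypothesis Om_reg : regular mu Om.
Hypothesis Om_pos : (0 < muo mu Om)%E.
Hypothesis Om_box : Om `<=` cbox a b.
Hypothesis N_oo : mindex_to_infty N.
Hypothesis x_au : au_grid a b N x.
Let I := fun n => [set i | mindex_box (N n) i /\ Om (x n i)].

Lemma finite_index n : finite_set (I n).
Proof. by apply: sub_finite_set (finite_mindex_box (N n)) => i []. Qed.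

(** The order [lt] is arbitrary and quantified after [n], so that the same bound serves the
    lexicographic order, the rank order of [sorted_pairing] and their reversals. *)
Lemma sorted_samples_le (f : d.-tuple R -> R) (lam : nat -> d.-tuple nat -> R) (lo hi e : R) :
  ae_continuous mu Om f -> asymp_distr mu I lam Om f ->
  (forall z, lo <= z <= hi -> ess_range mu Om f z) ->
  (forall y, Om y -> f y <= hi) ->
  (forall r, 0 < r -> \forall n \near \oo, forall i, I n i -> lo - r <= lam n i) ->
  0 < e ->
  \forall n \near \oo, forall (lt : d.-tuple nat -> d.-tuple nat -> Prop) sigma tau,
    set_bij (I n) (I n) sigma -> set_bij (I n) (I n) tau ->
    (forall i k, I n i -> I n k -> i = k \/ lt i k \/ lt k i) ->
    (forall i k, I n i -> I n k -> lt i k -> f (x n (sigma i)) <= f (x n (sigma k))) ->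
    (forall i k, I n i -> I n k -> lt i k -> lam n (tau i) <= lam n (tau k)) ->
    forall i, I n i -> f (x n (sigma i)) <= lam n (tau i) + e.
Proof.
move=> f_cont lamf ess fhi lamlo e0.
pose h := e / 4; have h0 : 0 < h by rewrite /h divr_gt0.
(* Every [j] with [lo + j * h <= hi] is below [J]; being finitely many, these thresholds are all
   treated by one large [n]. *)
pose J := (Num.truncn ((hi - lo) / h)).+1.
pose P j n := lo + j%:R * h <= hi ->
  (card_set [set i | I n i /\ (lam n i <= lo + j%:R * h - h)%R] <
   card_set [set i | I n i /\ (f (x n i) < lo + j%:R * h - h + 2 * h)%R])%N.
have Pnear m : \forall n \near \oo, forall j, (j < m)%N -> P j n.
  elim: m => [|m IH]; first by near=> n.
  have Pm : \forall n \near \oo, P m n.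
    have [mhi|mhi] := leP (lo + m%:R * h) hi; last by near=> n; rewrite /P leNgt mhi.
    have : \forall n \near \oo, (card_set [set i | I n i /\ (lam n i <= lo + m%:R * h - h)%R] <
        card_set [set i | I n i /\ (f (x n i) < lo + m%:R * h - h + 2 * h)%R])%N.
      apply: (count_below_lt mu_leb Om_reg Om_pos Om_box N_oo x_au f_cont lamf (lamlo _ ltr01)) => //.
      by rewrite subrK; apply: ess; rewrite mhi andbT lerDl mulr_ge0 // ltW.
    by apply: filterS => n Pn _.
  near=> n => j; rewrite ltnS leq_eqVlt => /predU1P[->|]; first by near: n.
  by move: j; near: n.
near=> n => lt sigma tau bs bt tot sf sl k Ik.
have PJ : forall j, (j < J)%N -> P j n by near: n; exact: Pnear.
have lamn : forall i, I n i -> lo - h <= lam n i by near: n; exact: lamlo.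
rewrite leNgt; apply/negP => lt_lf.
have [s1 _ _] := bs; have [t1 _ _] := bt.
have Itk : I n (tau k) by exact: t1.
have [_ Osk] : I n (sigma k) by exact: s1.
set l := lam n (tau k) in lt_lf; set g := f (x n (sigma k)) in lt_lf.
have ghi : g <= hi by exact: fhi.
have lol : lo - h <= l by exact: lamn.
have w0 : 0 <= (l + h - lo) / h by apply: divr_ge0; [lra|exact: ltW].
(* The threshold is [t = lo + m * h], for which [l < t <= l + h]. As [g > l + 4 * h], also
   [t + 2 * h < g], and [t + h] stays in the range. *)
have /andP[] := truncn_itv w0; set m := Num.truncn _.
rewrite ler_pdivlMr // ltr_pdivrMr // -natr1 => m1 m2.
have jE : m.+1%:R * h = m%:R * h + h by rewrite -natr1 mulrDl mul1r.
have m2' : l + h - lo < m%:R * h + h by rewrite mulrDl mul1r in m2.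
have e4 : e = 4 * h by rewrite /h mulrC divfK.
have jhi : lo + m.+1%:R * h <= hi by rewrite jE; lra.
have mJ : (m.+1 < J)%N.
  have y0 : 0 <= (hi - lo) / h.
    by rewrite divr_ge0 // ?ltW // subr_gt0; apply: lt_le_trans jhi; rewrite ltrDl mulr_gt0.
  have /andP[_ yJ] := truncn_itv y0.
  rewrite -(ltr_nat R); apply: le_lt_trans yJ.
  by rewrite ler_pdivlMr //; lra.
have := PJ _ mJ jhi; apply/negP; rewrite -leqNgt.
set t := lo + _ - h.
have lt_ : l <= t by rewrite /t jE; lra.
have tg : t + 2 * h <= g by rewrite /t jE; lra.
(* Permutations preserve both counts, which can thus be taken along the sorted vectors. There a
   sample below [t + 2 * h <= g] must precede position [k], so the [lambda] of its rank is at most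
   [l <= t]. *)
rewrite -(card_set_bij [set i | f (x n i) < t + 2 * h] (finite_index n) bs).
rewrite -(card_set_bij [set i | lam n i <= t] (finite_index n) bt).
apply: card_set_le; first by apply: sub_finite_set (finite_index n) => i [].
move=> i [Ii /= fi]; split => //=.
have [ik|[ik|ki]] := tot i k Ii Ik.
- by move: fi; rewrite ik ltNge tg.
- by apply: le_trans lt_; exact: sl.
- by have := sf _ _ Ik Ii ki; rewrite leNgt (lt_le_trans fi tg).
Unshelve. all: by end_near.
Qed.

Lemma cont_at_withinN (f : d.-tuple R -> R) y :
  cont_at_within Om f y -> cont_at_within Om (fun z => - f z) y.
Proof.
move=> c e /c[r r0 h]; exists r => // z Oz zy.
by rewrite -opprD normrN; exact: h.
Qed.

Lemma ae_continuousN (f : d.-tuple R -> R) :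
  ae_continuous mu Om f -> ae_continuous mu Om (fun z => - f z).
Proof.
move=> h; rewrite /ae_continuous -[RHS]h; congr (muo mu); apply/seteqP.
split => y [Oy c]; split => // c'; apply: c; first exact: cont_at_withinN.
move=> e /(cont_at_withinN c')[r r0 h']; exists r => // z Oz zy.
by have := h' z Oz zy; rewrite !opprK.
Qed.

Lemma ess_rangeN (f : d.-tuple R -> R) z :
  ess_range mu Om f (- z) -> ess_range mu Om (fun y => - f y) z.
Proof.
have E y : `|f y - - z| = `|- f y - z| by rewrite -normrN; congr (`|_|); ring.
by move=> h e /h; under eq_set do rewrite E.
Qed.

(** Test functions are stable under composition with negation. *)
Lemma asymp_distrN (f : d.-tuple R -> R) (lam : nat -> d.-tuple nat -> R) :
  asymp_distr mu I lam Om f -> asymp_distr mu I (fun n i => - lam n i) Om (fun y => - f y).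
Proof.
move=> [K h]; split => // F cF [M hM].
apply: (h (F \o -%R)).
  by move=> y; apply: continuous_comp; [exact: opp_continuous|exact: cF].
by exists M => y My /=; apply: hM; rewrite normrN.
Qed.

Lemma sorted_samples_dev (f : d.-tuple R -> R) (lam : nat -> d.-tuple nat -> R) (lo hi e : R) :
  ae_continuous mu Om f -> asymp_distr mu I lam Om f ->
  (forall z, lo <= z <= hi -> ess_range mu Om f z) ->
  (forall y, Om y -> lo <= f y <= hi) ->
  (forall r, 0 < r -> \forall n \near \oo, forall i, I n i -> lo - r <= lam n i <= hi + r) ->
  0 < e ->
  \forall n \near \oo, forall (lt : d.-tuple nat -> d.-tuple nat -> Prop) sigma tau,
    set_bij (I n) (I n) sigma -> set_bij (I n) (I n) tau ->
    (forall i k, I n i -> I n k -> i = k \/ lt i k \/ lt k i) ->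
    (forall i k, I n i -> I n k -> lt i k -> f (x n (sigma i)) <= f (x n (sigma k))) ->
    (forall i k, I n i -> I n k -> lt i k -> lam n (tau i) <= lam n (tau k)) ->
    max_dev (I n) (fun i => f (x n (sigma i))) (fun i => lam n (tau i)) <= e.
Proof.
move=> f_cont lamf ess flohi lamlohi e0.
have up : \forall n \near \oo, forall (lt : d.-tuple nat -> d.-tuple nat -> Prop) sigma tau,
    set_bij (I n) (I n) sigma -> set_bij (I n) (I n) tau ->
    (forall i k, I n i -> I n k -> i = k \/ lt i k \/ lt k i) ->
    (forall i k, I n i -> I n k -> lt i k -> f (x n (sigma i)) <= f (x n (sigma k))) ->
    (forall i k, I n i -> I n k -> lt i k -> lam n (tau i) <= lam n (tau k)) ->
    forall i, I n i -> f (x n (sigma i)) <= lam n (tau i) + e.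
  apply: (@sorted_samples_le f lam lo hi) => //.
    by move=> y /flohi/andP[].
  by move=> r /lamlohi; apply: filterS => n h i /h/andP[].
have down : \forall n \near \oo, forall (lt : d.-tuple nat -> d.-tuple nat -> Prop) sigma tau,
    set_bij (I n) (I n) sigma -> set_bij (I n) (I n) tau ->
    (forall i k, I n i -> I n k -> i = k \/ lt i k \/ lt k i) ->
    (forall i k, I n i -> I n k -> lt i k -> - f (x n (sigma i)) <= - f (x n (sigma k))) ->
    (forall i k, I n i -> I n k -> lt i k -> - lam n (tau i) <= - lam n (tau k)) ->
    forall i, I n i -> - f (x n (sigma i)) <= - lam n (tau i) + e.
  apply: (@sorted_samples_le (fun y => - f y) (fun n i => - lam n i) (- hi) (- lo)) => //.
  - exact: ae_continuousN.
  - exact: asymp_distrN.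
  - by move=> z hz; apply: ess_rangeN; apply: ess; lra.
  - by move=> y /flohi/andP[? _]; rewrite lerN2.
  - by move=> r /lamlohi; apply: filterS => n h i /h/andP[_ ?]; lra.
apply: filterS2 up down => n up down lt sigma tau bs bt tot sf sl.
apply: max_dev_le => [||i Ii]; [exact: finite_index|exact: ltW|].
have := up lt sigma tau bs bt tot sf sl i Ii.
(* Negation reverses monotonicity, hence the reversed order. *)
have := down (fun i k => lt k i) sigma tau bs bt.
have tot' : forall i k, I n i -> I n k -> i = k \/ lt k i \/ lt i k.
  by move=> j k Ij Ik; have [|[|]] := tot j k Ij Ik; auto.
move=> /(_ tot').
have sf' : forall i k, I n i -> I n k -> lt k i -> - f (x n (sigma i)) <= - f (x n (sigma k)).
  by move=> j k Ij Ik kj; rewrite lerN2; exact: sf.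
have sl' : forall i k, I n i -> I n k -> lt k i -> - lam n (tau i) <= - lam n (tau k).
  by move=> j k Ij Ik kj; rewrite lerN2; exact: sl.
move=> /(_ sf' sl' i Ii) h1 h2; rewrite ler_distl; apply/andP; split; lra.
Qed.

End SortedComparison.

Unset Implicit Arguments.
Set Strict Implicit.

Theorem theorem2p1 (R : realType) (d : nat)
  (mu : {measure set (d.-tuple R) -> \bar R})
  (Om : set (d.-tuple R)) (f : d.-tuple R -> R)
  (a b : d.-tuple R) (N : nat -> d.-tuple nat)
  (x : nat -> d.-tuple nat -> d.-tuple R)
  (lam : nat -> d.-tuple nat -> R) :
  (0 < d)%N ->
  is_lebesgue_d mu ->
  regular mu Om -> (0 < muo mu Om)%E ->
  bounded_on Om f -> ae_continuous mu Om f ->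
  ess_range mu Om f = [set z | inf (f @` Om) <= z <= sup (f @` Om)] ->
  Om `<=` [set y | forall j : 'I_d, tnth a j <= tnth y j <= tnth b j] ->
  mindex_to_infty N ->
  au_grid a b N x ->
  let I := fun n => [set i | mindex_box (N n) i /\ Om (x n i)] in
  asymp_distr mu I lam Om f ->
  (exists eps : nat -> R, eps @ \oo --> 0 /\
     forall n i, I n i ->
       inf (f @` Om) - eps n <= lam n i <= sup (f @` Om) + eps n) ->
  (forall sigma tau : nat -> d.-tuple nat -> d.-tuple nat,
     (forall n, set_bij (I n) (I n) (sigma n)) ->
     (forall n, set_bij (I n) (I n) (tau n)) ->
     (forall n i k, I n i -> I n k -> lexlt i k ->
        f (x n (sigma n i)) <= f (x n (sigma n k))) ->
     (forall n i k, I n i -> I n k -> lexlt i k ->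
        lam n (tau n i) <= lam n (tau n k)) ->
     (fun n => max_dev (I n) (fun i => f (x n (sigma n i)))
                             (fun i => lam n (tau n i))) @ \oo --> 0)
  /\
  (fun n => inf [set max_dev (I n) (fun i => f (x n i)) (fun i => lam n (tau i))
                 | tau in [set tau : d.-tuple nat -> d.-tuple nat |
                            set_bij (I n) (I n) tau]]) @ \oo --> 0.
Proof.
move=> d_gt0 mu_leb Om_reg Om_pos [B fB] f_cont ess Om_box N_oo x_au I lamf [eps [eps0 lam_eps]].
(* Boundedness of [f] makes [inf] and [sup] genuine bounds instead of default values. *)
have f_lohi y : Om y -> inf (f @` Om) <= f y <= sup (f @` Om).
  move=> Oy; apply/andP; split.
    apply: ge_inf; last by exists y.
    by exists (- B) => _ [z Oz <-]; have := fB z Oz; rewrite ler_norml => /andP[].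
  apply: ub_le_sup; last by exists y.
  by exists B => _ [z Oz <-]; have := fB z Oz; rewrite ler_norml => /andP[].
have lam_lohi r : 0 < r -> \forall n \near \oo, forall i, I n i ->
    inf (f @` Om) - r <= lam n i <= sup (f @` Om) + r.
  move=> r0; have eps_lt : \forall n \near \oo, eps n < r by exact: cvgr_lt eps0 _ r0.
  apply: filterS eps_lt => n epsr i /lam_eps/andP[? ?].
  by apply/andP; split; lra.
have dev e (e0 : 0 < e) := sorted_samples_dev mu_leb Om_reg Om_pos Om_box N_oo x_au
  f_cont lamf (fun z hz => eq_ind_r (fun S => S z) hz ess) f_lohi lam_lohi e0.
split=> [sigma tau bs bt sf sl|].
  apply/cvgrPdist_le => e e0; have := dev e e0; apply: filterS => n dev_n.
  rewrite sub0r normrN ger0_norm ?max_dev_ge0 //.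
  exact: (dev_n lexlt (sigma n) (tau n) (bs n) (bt n) (fun i k _ _ => lexlt_total i k)
    (sf n) (sl n)).
apply/cvgrPdist_le => e e0; have := dev e e0; apply: filterS => n dev_n.
have fI : finite_set (I n) by apply: sub_finite_set (finite_mindex_box (N n)) => i [].
(* The rank-matching permutation is one competitor in the infimum, and [dev] applies to it with the
   identity on the samples. *)
have [tau [lt [bt tot sf sl]]] := sorted_pairing (fun i => f (x n i)) (lam n) fI.
have bid : set_bij (I n) (I n) id by split => // i Ii; exists i.
have le_e := dev_n lt id tau bid bt tot sf sl.
rewrite sub0r normrN ger0_norm.
  apply: le_trans le_e; apply: ge_inf; last by exists tau.
  by exists 0 => _ [? _ <-]; exact: max_dev_ge0.
(* A lower bound passes to [inf] only for a nonempty set, and [tau] provides an element. *)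
apply: lb_le_inf; first by eexists; exists tau.
by move=> _ [? _ <-]; exact: max_dev_ge0.
Qed.
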